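(* Let $G$ be a connected graph of girth at least $6$ which is isomorphic to neither the cycle $C_{7}$ nor $K_{1}$. The following are equivalent: (i) $G$ is well-covered; (ii) $G$ has a perfect matching consisting of pendant edges; (iii) $G$ is very well-covered; (iv) $G$ is a König–Egerváry graph with exactly $\alpha(G)$ pendant vertices and $core(G)=\emptyset$; (v) $G$ is a König–Egerváry graph and is square-stable.
   Context: All graphs are finite and simple; the girth is the length of a shortest cycle (infinite for acyclic graphs). $\alpha(G)$ is the maximum size of a stable set (set of pairwise non-adjacent vertices), $\mu(G)$ the maximum size of a matching; $G$ is König–Egerváry if $\alpha(G)+\mu(G)=|V(G)|$. $core(G)$ is the intersection of all maximum stable sets of $G$. $G$ is well-covered if every maximal stable set is maximum; very well-covered if it is well-covered, has no isolated vertices and $|V(G)|=2\alpha(G)$. A vertex is pendant if it has exactly one neighbour; an edge incident to a pendant vertex is a pendant edge. $G^{2}$ is the graph on $V(G)$ in which distinct $u,v$ are adjacent iff $dist_G(u,v)\le 2$; $G$ is square-stable if $\alpha(G)=\alpha(G^{2})$.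
   Formalization: The implications from (i), (ii), (iii), (v) to (iv) are asserted only for G not isomorphic to K_2, since K_2 satisfies (i), (ii), (iii), (v) but has 2 pendant vertices while its α is 1; all other implications are proved for every G, K_2 included. *)

(* Defs.v *)
From mathcomp Require Import all_boot.
Set Implicit Arguments.
Unset Strict Implicit.
Unset Printing Implicit Defensive.

(* A finite simple graph is a symmetric irreflexive relation e on a finType T.
   Girth and distance take values in option nat, with None for infinity. *)

Section Graph.
Variables (T : finType) (e : rel T).

Definition neighbours (x : T) : {set T} := [set y | e x y].

Definition connected : Prop := forall x y : T, connect e x y.

Definition has_cycle (k : nat) : bool :=
  [exists c : k.-tuple T, uniq c && cycle e c].

(* Cycle lengths range over 3, ..., #|T| + 2, in increasing order; a cycle has
   at most #|T| vertices.  Starting at 3 is essential: for a symmetric e,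
   [:: x; y] is a "cycle" in the sense of path.v as soon as e x y. *)
Definition girth : option nat := ohead [seq k <- iota 3 #|T| | has_cycle k].

Definition girth_at_least (g : nat) : bool :=
  if girth is Some k then g <= k else true.

Definition has_walk (x y : T) (k : nat) : bool :=
  [exists p : k.-tuple T, path e x p && (last x p == y)].

(* Finite distances are smaller than #|T|. *)
Definition dist (x y : T) : option nat :=
  ohead [seq k <- iota 0 #|T| | has_walk x y k].

Definition square : rel T :=
  fun x y => (x != y) && (if dist x y is Some d then d <= 2 else false).

Definition stable (S : {set T}) : bool :=
  [forall x in S, forall y in S, ~~ e x y].

Definition alpha : nat := \max_(S : {set T} | stable S) #|S|.

Definition maximum_stable (S : {set T}) : bool := stable S && (#|S| == alpha).

Definition core : {set T} := \bigcap_(S : {set T} | maximum_stable S) S.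

Definition edges : {set {set T}} :=
  [set A | [exists x, exists y, e x y && (A == [set x; y])]].

Definition matching (M : {set {set T}}) : bool :=
  (M \subset edges) && trivIset M.

Definition mu : nat := \max_(M : {set {set T}} | matching M) #|M|.

Definition perfect_matching (M : {set {set T}}) : bool :=
  matching M && (cover M == [set: T]).

Definition Konig_Egervary : bool := alpha + mu == #|T|.

Definition well_covered : bool :=
  [forall S : {set T}, maxset stable S ==> maximum_stable S].

Definition isolated (x : T) : bool := neighbours x == set0.

Definition very_well_covered : bool :=
  [&& well_covered, [forall x, ~~ isolated x] & #|T| == 2 * alpha].

Definition pendant (x : T) : bool := #|neighbours x| == 1.

Definition pendant_edge (A : {set T}) : bool :=
  (A \in edges) && [exists x in A, pendant x].

Definition pendant_perfect_matching : bool :=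
  [exists M : {set {set T}},
     perfect_matching M && [forall A in M, pendant_edge A]].

Definition Konig_Egervary_pendant_core : bool :=
  [&& Konig_Egervary, #|[set x | pendant x]| == alpha & core == set0].

End Graph.

Definition square_stable (T : finType) (e : rel T) : bool :=
  alpha e == alpha (square e).

Definition isomorphic (T1 T2 : finType) (e1 : rel T1) (e2 : rel T2) : Prop :=
  exists2 f : T1 -> T2, bijective f & forall x y, e2 (f x) (f y) = e1 x y.

Definition complete_graph (n : nat) : rel 'I_n := fun i j => i != j.

Definition cycle_graph (n : nat) : rel 'I_n :=
  fun i j => (j == ordS i) || (i == ordS j).

(* Main.v *)
Require Import Defs.
From mathcomp Require Import all_boot.
(* Only (i) => (ii) is hard.  Call an induced subgraph well-covered when its
   maximal stable sets are equicardinal.  Deleting a closed neighbourhood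
   preserves this, and two leaves of a well-covered graph never share a
   neighbour.  By induction on the vertex set A, every vertex of a well-covered
   G[A] of girth at least 6 is isolated, lies on a pendant edge, or lies on a
   component C7.
   If A has a leaf l, apply the induction hypothesis to A - N[l]: wherever the
   neighbour of l attaches to a pendant edge or to a C7 of A - N[l], deleting
   one or two more closed neighbourhoods creates two leaves with a common
   neighbour.  If A has no leaf but A - N[v] has one, the absence of cycles of
   length at most 5 forces a component v u l s s' l' u' isomorphic to C7.
   Otherwise A - N[x] has only C7 components; if one of them is c0 ... c6 with
   c0 at distance 2 from x, then c6 is a leaf of A - N[c1], so c1 lies on a
   component C7 of A, contradicting that c0 has degree 3.

   (ii) is handled as an involution f with x adjacent to f x and x or f x
   pendant: a maximal stable set contains exactly one of x and f x.  (iv) and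
   (v) give (ii) since, in a Konig-Egervary graph, the complement of a maximum
   stable set S is matched into S; take S to be the set of pendant vertices,
   respectively a maximum stable set of the square. *)

Set Implicit Arguments.
Unset Strict Implicit.
Unset Printing Implicit Defensive.

(** Both [girth] and [dist] are heads of a filtered [iota]; since [iota] is increasing, such a head
    is the least element. *)
Lemma ohead_filter_iota (P : pred nat) m n :
  if ohead [seq k <- iota m n | P k] is Some k
  then [/\ P k, m <= k & forall j, m <= j < m + n -> P j -> k <= j]
  else forall j, m <= j < m + n -> ~~ P j.
Proof.
have mem j : m <= j < m + n -> P j -> j \in [seq k <- iota m n | P k].
  by rewrite mem_filter mem_iota => -> ->.
have : sorted ltn [seq k <- iota m n | P k].
  by apply: sorted_filter (iota_ltn_sorted m n); exact: ltn_trans.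
have : all (fun k => P k && (m <= k)) [seq k <- iota m n | P k].
  by apply/allP => k; rewrite mem_filter mem_iota => /and3P[-> ->].
case: [seq k <- iota m n | P k] mem => [|k s] mem /= => [_ _ j mj|].
  by apply/negP => /(mem j mj).
move=> /andP[/andP[Pk mk] _] /(order_path_min ltn_trans)/allP min_k; split=> // j mj Pj.
by have := mem j mj Pj; rewrite inE => /predU1P[-> //|/min_k/ltnW].
Qed.

(** * Maximum stable sets and maximum matchings *)

Section Maxima.
Variables (T : finType) (e : rel T).

Lemma stableP (S : {set T}) :
  reflect {in S &, forall x y, ~~ e x y} (stable e S).
Proof.
apply: (iffP forallP) => [st x y xS yS | st x].
  by have /implyP/(_ xS)/forallP/(_ y)/implyP/(_ yS) := st x.
by apply/implyP => xS; apply/forallP => y; apply/implyP => yS; exact: st.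
Qed.

Lemma alpha_ge (S : {set T}) : stable e S -> #|S| <= alpha e.
Proof. exact: leq_bigmax_cond. Qed.

Lemma maximum_stable_exists : exists S, maximum_stable e S.
Proof.
have st0 : stable e set0 by apply/forallP => x; rewrite inE.
have [|S stS aS] := eq_bigmax_cond (fun S : {set T} => #|S|) (A := stable e).
  by apply/card_gt0P; exists set0.
by exists S; apply/andP; split; [exact: stS | apply/eqP; exact: esym aS].
Qed.

Lemma mu_ge M : matching e M -> #|M| <= mu e.
Proof. exact: leq_bigmax_cond. Qed.

Lemma maximum_matching_exists : exists2 M, matching e M & #|M| = mu e.
Proof.
have m0 : matching e set0.
  by rewrite /matching sub0set; apply/trivIsetP => A B; rewrite inE.
have [|M mM aM] := eq_bigmax_cond (fun M : {set {set T}} => #|M|) (A := matching e).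
  by apply/card_gt0P; exists set0.
by exists M; [exact: mM | exact: esym aM].
Qed.

End Maxima.

Section Graph.
Variables (T : finType) (e : rel T).
Hypotheses (e_sym : symmetric e) (e_irr : irreflexive e).

Lemma adjC x y : e x y -> e y x. Proof. by rewrite e_sym. Qed.

Lemma stableU1 x (S : {set T}) :
  stable e S -> {in S, forall y, ~~ e x y} -> stable e (x |: S).
Proof.
move=> /stableP st xS; apply/stableP => y z /setU1P[-> | yS] /setU1P[-> | zS].
- by rewrite e_irr.
- exact: xS.
- by rewrite e_sym xS.
- exact: st.
Qed.

Lemma stableS (S S' : {set T}) : S \subset S' -> stable e S' -> stable e S.
Proof.
move=> /subsetP sSS' /stableP st; apply/stableP => x y /sSS' xS /sSS' yS.
exact: st.
Qed.

(** * Well-covered induced subgraphs and their leaves *)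

Definition maximal_stable_in (A S : {set T}) : Prop :=
  [/\ stable e S, S \subset A &
      forall x, x \in A -> x \notin S -> exists2 y, y \in S & e y x].

(** Comparing two maximal stable sets avoids an independence number relative to [A]. *)
Definition well_covered_in (A : {set T}) : Prop :=
  forall S S', maximal_stable_in A S -> maximal_stable_in A S' -> #|S| = #|S'|.

(** An undominated vertex could be added without losing stability, so maximality under inclusion
    amounts to domination. *)
Lemma maximal_stable_inP (A S : {set T}) :
  maxset (fun S => stable e S && (S \subset A)) S <-> maximal_stable_in A S.
Proof.
split=> [/maxsetP[/andP[st SA] mx] | [st SA dom]].
  split=> // x xA xS; apply/exists_inP/contraT => /exists_inPn noadj.
  suff eqS : x |: S = S by rewrite -eqS setU11 in xS.
  apply: mx; last exact: subsetU1.
  rewrite subUset sub1set xA SA !andbT.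
  by apply: stableU1 => // y yS; rewrite e_sym noadj.
apply/maxsetP; rewrite st SA; split=> // S' /andP[/stableP st' S'A] SS'.
apply/eqP; rewrite eqEsubset SS' andbT; apply/subsetP => x xS'.
apply/contraT => xS; have [y yS] := dom x (subsetP S'A x xS') xS.
by rewrite (negPf (st' y x (subsetP SS' y yS) xS')).
Qed.

Lemma maximal_stable_in_exists (A S : {set T}) : stable e S -> S \subset A ->
  exists2 S', maximal_stable_in A S' & S \subset S'.
Proof.
move=> st SA.
pose P := fun S => stable e S && (S \subset A).
have PS : P S by rewrite /P st.
have [S' mS' SS'] := maxset_exists PS.
by exists S' => //; apply/maximal_stable_inP.
Qed.

Definition leaf (A : {set T}) (x y : T) : Prop :=
  [/\ x \in A, y \in A, e x y & forall z, z \in A -> e x z -> z = y].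

Definition delN (A : {set T}) (z : T) : {set T} :=
  [set x in A | (x != z) && ~~ e z x].

Lemma in_delN (A : {set T}) z x : (x \in delN A z) = [&& x \in A, x != z & ~~ e z x].
Proof. by rewrite inE. Qed.

Lemma delN_sub (A : {set T}) z x : x \in delN A z -> x \in A.
Proof. by rewrite in_delN => /and3P[]. Qed.

(** Adding [z] turns a maximal stable set of [A - N[z]] into one of [A] with one more element. *)
Lemma well_covered_delN (A : {set T}) z :
  z \in A -> well_covered_in A -> well_covered_in (delN A z).
Proof.
move=> zA wc.
have ext S : maximal_stable_in (delN A z) S ->
    maximal_stable_in A (z |: S) /\ #|z |: S| = #|S|.+1.
  move=> [st /subsetP SA dom]; split; last first.
    by rewrite cardsU1; case: (boolP (z \in S)) => // /SA; rewrite in_delN eqxx andbF.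
  split.
  - by apply: stableU1 => // y /SA; rewrite in_delN => /and3P[].
  - by apply/subsetP => y /setU1P[-> // | /SA/delN_sub].
  move=> x xA; rewrite in_setU1 negb_or => /andP[xz xS].
  case: (boolP (e z x)) => [ezx | nezx]; first by exists z; rewrite ?setU11.
  have [|y yS eyx] := dom x _ xS; first by rewrite in_delN xA xz.
  by exists y => //; rewrite setU1r.
move=> S S' /ext[mS cS] /ext[mS' cS']; apply: succn_inj.
by rewrite -cS -cS'; exact: wc.
Qed.

(** Within [A] the leaves [l] and [l'] see only [s], so trading [s] for both gains one element. *)
Lemma leaf_swap (A S : {set T}) l l' s :
  leaf A l s -> leaf A l' s -> l != l' -> stable e S -> S \subset A ->
  s \in S -> let S' := l |: (l' |: S :\ s) in
  [/\ stable e S', S' \subset A & #|S'| = #|S|.+1].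
Proof.
move=> [lA sA els Nl] [l'A _ el's Nl'] ll' stS /subsetP SA sS S'.
have /stableP st := stS.
have noadj x y : y \in S :\ s -> (forall z, z \in A -> e x z -> z = s) -> ~~ e x y.
  move=> /setD1P[ys yS] Nx; apply/negP => /(Nx _ (SA _ yS)) ys'.
  by rewrite ys' eqxx in ys.
split.
- apply: stableU1 => [|y].
    apply: stableU1 => [|y yS]; first exact: stableS (subD1set S s) stS.
    exact: noadj yS _.
  move=> /setU1P[->|yS]; last exact: noadj yS _.
  by apply/negP => /(Nl _ l'A) l's; rewrite l's e_irr in el's.
- by apply/subsetP => y /setU1P[->//|/setU1P[->//|/setD1P[_ /SA]//]].
have lS : l \notin S by apply/negP => /st/(_ sS); rewrite els.
have l'S : l' \notin S by apply/negP => /st/(_ sS); rewrite el's.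
rewrite (cardsD1 s S) sS /S' !cardsU1 !inE (negPf ll') (negPf lS) (negPf l'S).
by rewrite !andbF.
Qed.

(** Given two leaves at [s], a maximal stable set through [s] could be swapped and extended to a
    strictly larger maximal one. *)
Lemma leaf_unique (A : {set T}) l l' s :
  well_covered_in A -> leaf A l s -> leaf A l' s -> l = l'.
Proof.
move=> wc ls l's; apply/eqP/contraT => ll'; have [_ sA _ _] := ls.
have s_st : stable e [set s] by apply/stableP => x y /set1P-> /set1P->; rewrite e_irr.
have [|S mS /subsetP sS] := maximal_stable_in_exists s_st (A := A).
  by rewrite sub1set.
have [stS SA _] := mS; have{}sS : s \in S by rewrite sS ?set11.
have [st' S'A cS'] := leaf_swap ls l's ll' stS SA sS.
have [S' mS' sS'] := maximal_stable_in_exists st' S'A.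
by have := subset_leq_card sS'; rewrite cS' (wc _ _ mS mS') ltnn.
Qed.

(** * Girth, distance two, pendant vertices and edges *)

Lemma uniq_size_le (s : seq T) : uniq s -> size s <= #|T|.
Proof. by move=> /card_uniqP <-; exact: max_card. Qed.

Lemma girth_cycle g (c : seq T) : girth_at_least e g ->
  2 < size c < g -> uniq c -> ~~ cycle e c.
Proof.
rewrite /girth_at_least /girth => girth_g /andP[c3 cg] uc; apply/negP => cyc.
have hc : has_cycle e (size c).
  by apply/existsP; exists (in_tuple c); rewrite /= uc.
(* A cycle without repetition has at most [#|T|] vertices, so its length lies in the range scanned
   by [girth]. *)
have cT : 3 <= size c < 3 + #|T|.
  by rewrite c3 (leq_ltn_trans (uniq_size_le uc)) // -[X in X < _]add0n ltn_add2r.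
have := ohead_filter_iota (has_cycle e) 3 #|T|.
case: ohead girth_g => [k gk [_ _ /(_ _ cT hc)] | _ /(_ _ cT)]; last by rewrite hc.
by move=> /(leq_trans gk); rewrite leqNgt cg.
Qed.

Lemma squareE x y :
  square e x y = (x != y) && (e x y || [exists z, e x z && e z y]).
Proof.
rewrite /square; case: eqVneq => //= xy.
have neq a b : e a b -> a != b by apply: contraTneq => ->; rewrite e_irr.
(* [dist] scans only lengths below [#|T|]; each use of this fact exhibits [k.+1] distinct
   vertices. *)
have dist_le k : k < #|T| -> k <= 2 -> has_walk e x y k ->
    if dist e x y is Some d then d <= 2 else false.
  move=> kT k2 wk; have := ohead_filter_iota (has_walk e x y) 0 #|T|.
  rewrite /dist; case: ohead => [d [_ _ /(_ k kT wk)] | /(_ k kT)].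
    by move=> /leq_trans; apply.
  by rewrite wk.
apply/idP/idP => [|/orP[exy | /existsP[z /andP[exz ezy]]]].
- rewrite /dist; have := ohead_filter_iota (has_walk e x y) 0 #|T|.
  case: ohead => // d [/existsP[[p /= /eqP<-]] /andP[xp /eqP lp] _ _].
  case: p xp lp => [_ /= eqxy|z [|t [|//]]] /=; first by rewrite eqxy eqxx in xy.
    by move=> /andP[exz _] <-; rewrite exz.
  move=> /and3P[exz ezt _] <- _; apply/orP; right; apply/existsP; exists z.
  by rewrite exz.
- apply: (dist_le 1) => //.
    by apply: (@uniq_size_le [:: x; y]); rewrite /= inE xy.
  by apply/existsP; exists [tuple y]; rewrite /= exy eqxx.
apply: (dist_le 2) => //.
  apply: (@uniq_size_le [:: x; z; y]).
  by rewrite /= !inE negb_or xy (neq _ _ exz) (neq _ _ ezy).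
by apply/existsP; exists [tuple z; y]; rewrite /= exz ezy eqxx.
Qed.

Lemma pendantP x :
  reflect (exists2 y, e x y & forall z, e x z -> z = y) (pendant e x).
Proof.
apply: (iffP cards1P) => [[y Ny] | [y exy Ny]]; exists y.
- by have := set11 y; rewrite -Ny inE.
- by move=> z exz; apply/set1P; rewrite -Ny inE.
by apply/setP => z; rewrite !inE; apply/idP/eqP => [/Ny|->].
Qed.

Lemma edgesP (A : {set T}) :
  reflect (exists x y, e x y /\ A = [set x; y]) (A \in edges e).
Proof.
rewrite inE; apply: (iffP existsP) => [[x /existsP[y /andP[exy /eqP->]]] | ].
  by exists x, y.
by move=> [x [y [exy ->]]]; exists x; apply/existsP; exists y; rewrite exy eqxx.
Qed.

(** * Matchings and Konig-Egervary graphs *)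

Lemma edge_eq x y y' : e x y -> [set x; y] = [set x; y'] -> y = y'.
Proof.
move=> exy /setP/(_ y); rewrite !inE eqxx orbT => /esym/orP[/eqP yx|/eqP //].
by rewrite yx e_irr in exy.
Qed.

Lemma matching_card M : matching e M -> #|cover M| = #|M| * 2.
Proof.
move=> /andP[/subsetP ME /eqP <-]; rewrite -sum_nat_const; apply: eq_bigr => A.
move=> /ME/edgesP[x [y [exy ->]]]; rewrite cards2.
by case: eqVneq exy => // ->; rewrite e_irr.
Qed.

Lemma matching_edge_eq M A B x : matching e M -> A \in M -> B \in M ->
  x \in A -> x \in B -> A = B.
Proof.
move=> /andP[_ tM] AM BM xA xB.
by rewrite -(def_pblock tM AM xA) (def_pblock tM BM xB).
Qed.

(* Each edge of a maximum matching has an end outside [S]; as there are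
   [#|~: S|] such edges, these ends exhaust [~: S]. *)
Lemma Konig_Egervary_matched S : Konig_Egervary e -> maximum_stable e S ->
  exists2 g : T -> T, {in ~: S &, injective g} &
    forall x, x \notin S -> g x \in S /\ e x (g x).
Proof.
move=> /eqP KE /andP[/forall_inP stS /eqP aS].
have [M mM cM] := maximum_matching_exists e.
have cSC : #|~: S| = #|M|.
  by apply/eqP; rewrite -(eqn_add2l #|S|) cardsC cM aS KE.
have stF x y : x \in S -> y \in S -> e x y = false.
  by move=> xS yS; apply/negbTE; have /forall_inP := stS x xS; apply.
have ME A : A \in M -> exists x y, e x y /\ A = [set x; y].
  by move=> AM; apply/edgesP; case/andP: mM => /subsetP/(_ A AM).
have matched x : x \notin S -> exists y, [/\ y \in S, e x y & [set x; y] \in M].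
  (* [h] picks an end of each matching edge outside [S]; the default [x] never occurs, since no edge
     lies inside a stable set. *)
  move=> xS; pose h (A : {set T}) := odflt x [pick y in A :\: S].
  have hP A : A \in M -> h A \in A /\ h A \notin S.
    move=> AM; rewrite /h; case: pickP => [y /setDP[] // | none].
    have [a [b [eab defA]]] := ME A AM; have := none a; have := none b.
    rewrite !inE defA !inE !eqxx orbT !andbT => /negbFE bS /negbFE aS'.
    by rewrite stF in eab.
  have h_inj : {in M &, injective h}.
    move=> A B AM BM hAB; have [hA _] := hP A AM; have [hB _] := hP B BM.
    by apply: matching_edge_eq mM AM BM hA _; rewrite hAB.
  have hM : h @: M = ~: S.
    apply/eqP; rewrite eqEcard card_in_imset // cSC leqnn andbT.
    by apply/subsetP => _ /imsetP[A AM ->]; rewrite inE; have [] := hP A AM.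
  have : x \in h @: M by rewrite hM inE.
  move=> /imsetP[A AM xA]; have [hA _] := hP A AM; rewrite -xA in hA.
  have [y [exy defA]] : exists y, e x y /\ A = [set x; y].
    have [a [b [eab defA]]] := ME A AM; move: hA; rewrite defA => /set2P[->|->].
      by exists b.
    by exists a; rewrite e_sym setUC.
  (* If both ends of [A] were outside [S], each would be the end chosen by [h] for an edge of [M];
     disjointness makes that edge [A] in both cases, so the ends would be equal. *)
  exists y; rewrite -defA; split=> //; apply/contraT => yS.
  have : y \in h @: M by rewrite hM inE.
  move=> /imsetP[B BM yB]; have [hB _] := hP B BM; rewrite -yB in hB.
  have AB : A = B by apply: matching_edge_eq mM AM BM _ hB; rewrite defA set22.
  by move: exy; rewrite xA yB AB e_irr.
pose g x := odflt x [pick y | [&& y \in S, e x y & [set x; y] \in M]].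
have gP x : x \notin S -> [&& g x \in S, e x (g x) & [set x; g x] \in M].
  rewrite /g; case: pickP => [//|none] /matched[y [yS exy yM]].
  by have := none y; rewrite yS exy yM.
exists g => [x y | x /gP/and3P[] //]; rewrite !inE => xS yS gxy.
have /and3P[gS _ gM] := gP x xS; have /and3P[_ _ gM'] := gP y yS.
have := matching_edge_eq mM gM gM' (set22 _ _); rewrite gxy set22 => /(_ isT).
move=> /setP/(_ x); rewrite !inE eqxx /= => /esym/orP[/eqP //|/eqP xg].
by rewrite xg -gxy gS in xS.
Qed.

(** * Consequences of a pendant perfect matching *)

Definition pendant_pairing (f : T -> T) : Prop :=
  involutive f /\ forall x, e x (f x) /\ (pendant e x || pendant e (f x)).

Lemma pendant_pairing_of_perfect_matching :
  pendant_perfect_matching e -> exists f, pendant_pairing f.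
Proof.
move=> /existsP[M /andP[/andP[mM /eqP cov] /forall_inP pM]].
have ME A : A \in M -> exists x y, e x y /\ A = [set x; y].
  by move=> AM; apply/edgesP; case/andP: mM => /subsetP/(_ A AM).
have matched x : exists y, e x y && ([set x; y] \in M).
  have : x \in cover M by rewrite cov.
  move=> /bigcupP[A AM]; have [a [b [eab defA]]] := ME A AM.
  rewrite defA in AM *; move=> /set2P[->|->]; first by exists b; rewrite eab.
  by exists a; rewrite e_sym eab setUC.
pose f x := odflt x [pick y | e x y && ([set x; y] \in M)].
have fP x : e x (f x) && ([set x; f x] \in M).
  rewrite /f; case: pickP => [//|none]; have [y xy] := matched x.
  by have := none y; rewrite /= xy.
exists f; split=> [x|x]; have /andP[ex xM] := fP x.
  have /andP[efx fxM] := fP (f x).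
  apply: (@edge_eq (f x)) => //.
  apply: matching_edge_eq mM fxM _ (set21 _ _) (set21 _ _).
  by rewrite setUC.
split=> //; have /andP[_ /exists_inP[z /set2P[->|->] ->]] := pM _ xM => //.
by rewrite orbT.
Qed.

Section Pairing.
Variable f : T -> T.
Hypothesis fP : pendant_pairing f.

Let fK : involutive f. Proof. by case: fP. Qed.
Let e_f x : e x (f x). Proof. by case: fP => _ /(_ x)[]. Qed.

Lemma pairing_pendant x y : pendant e x -> e x y -> y = f x.
Proof. by move=> /pendantP[z _ N] /N ->; rewrite (N (f x)). Qed.

Lemma pairing_matching : pendant_perfect_matching e /\
  exists2 M, matching e M & #|M| * 2 = #|T|.
Proof.
pose M := [set [set x; f x] | x in T].
have pairE x z : z \in [set x; f x] -> [set x; f x] = [set z; f z].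
  by move=> /set2P[->|->] //; rewrite fK setUC.
have mM : matching e M.
  apply/andP; split.
    by apply/subsetP => _ /imsetP[x _ ->]; apply/edgesP; exists x, (f x).
  apply/trivIsetP => _ _ /imsetP[x _ ->] /imsetP[y _ ->]; apply: contraNT.
  rewrite -setI_eq0 => /set0Pn[z /setIP[/pairE -> /pairE ->]].
  exact: eqxx.
have cov : cover M = setT.
  apply/setP => x; rewrite inE; apply/bigcupP; exists [set x; f x].
    exact: imset_f.
  exact: set21.
split; last by exists M; rewrite // -matching_card // cov cardsT.
apply/existsP; exists M; rewrite /perfect_matching mM cov eqxx /=.
apply/forall_inP => _ /imsetP[x _ ->]; apply/andP; split.
  by apply/edgesP; exists x, (f x).
have [_ /(_ x)[_ /orP[px|px]]] := fP; apply/exists_inP.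
  by exists x; rewrite // set21.
by exists (f x); rewrite // set22.
Qed.

(** Adjacency forbids both ends. If neither were in [S], the pendant end would be undominated, its
    only neighbour being the other end. *)
Lemma pairing_maximal S x :
  maximal_stable_in setT S -> (f x \in S) = (x \notin S).
Proof.
move=> [/stableP st _ dom]; apply/idP/idP => [fxS | xS].
  by apply/negP => xS; have := st x (f x) xS fxS; rewrite e_f.
apply/contraT => fxS; have [_ /(_ x)[_ /orP[px|px]]] := fP.
  have [y yS] := dom x (in_setT x) xS; rewrite e_sym.
  by move=> /(pairing_pendant px) yE; rewrite -yE yS in fxS.
have [y yS] := dom (f x) (in_setT _) fxS; rewrite e_sym.
by move=> /(pairing_pendant px); rewrite fK => yE; rewrite -yE yS in xS.
Qed.

(** The involution exchanges [S] with its complement. *)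
Lemma pairing_half (S : {set T}) :
  (forall x, (f x \in S) = (x \notin S)) -> #|S| * 2 = #|T|.
Proof.
move=> fS; suff SC : ~: S = f @: S.
  by rewrite -(cardsC S) SC (card_imset _ (inv_inj fK)) muln2 addnn.
apply/setP => x; rewrite inE -fS; apply/idP/imsetP => [fxS | [y yS ->]].
  by exists (f x); rewrite ?fK.
by rewrite fK.
Qed.

Lemma pairing_alpha : alpha e * 2 = #|T|.
Proof.
have [S /andP[stS /eqP aS]] := maximum_stable_exists e.
have [S' mS' SS'] := maximal_stable_in_exists stS (subsetT S).
have [stS' _ _] := mS'; rewrite -(pairing_half (fun x => pairing_maximal x mS')).
congr (_ * 2); apply/eqP; rewrite eqn_leq alpha_ge // -aS andbT.
exact: subset_leq_card.
Qed.

Lemma pairing_maximum (S : {set T}) : stable e S -> #|S| * 2 = #|T| ->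
  maximum_stable e S.
Proof.
move=> stS cS; apply/andP; split=> //.
by rewrite -(eqn_pmul2r (isT : 0 < 2)) cS pairing_alpha.
Qed.

Lemma pairing_maximal_maximum S :
  maximal_stable_in setT S -> maximum_stable e S.
Proof.
move=> mS; have [stS _ _] := mS; apply: pairing_maximum => //.
exact: pairing_half (fun x => pairing_maximal x mS).
Qed.

Lemma pairing_very_well_covered : very_well_covered e.
Proof.
apply/and3P; split; last by rewrite mulnC pairing_alpha.
  apply/forallP => S; apply/implyP => mS; apply: pairing_maximal_maximum.
  apply/maximal_stable_inP; rewrite (@maxset_eq _ _ (stable e)) // => S'.
  by rewrite subsetT andbT.
apply/forallP => x; apply/negP => /eqP/setP/(_ (f x)).
by rewrite !inE e_f.
Qed.

(** Both [alpha e] and [mu e] are half the number of vertices. *)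
Lemma pairing_Konig_Egervary : Konig_Egervary e.
Proof.
have [_ [M mM cM]] := pairing_matching.
have [M' mM' cM'] := maximum_matching_exists e.
suff mu2 : mu e * 2 = #|T|.
  rewrite /Konig_Egervary -(eqn_pmul2r (isT : 0 < 2)) mulnDl pairing_alpha mu2.
  by rewrite muln2 addnn.
apply/eqP; rewrite eqn_leq -{2}cM leq_mul2r mu_ge // orbT andbT.
by rewrite -cM' -matching_card // max_card.
Qed.

(** Sets stable in the square are stable in the graph, so it suffices to find one containing half of
    the vertices. *)
Lemma pairing_square_stable : square_stable e.
Proof.
(* [L] takes one pendant end of each pair; when both ends are pendant, [enum_rank] breaks the
   tie. *)
pose L := [set x | pendant e x &&
                   (~~ pendant e (f x) || (enum_rank x < enum_rank (f x)))].
have L_half : #|L| * 2 = #|T|.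
  apply: pairing_half => x; rewrite !inE fK.
  have [_ /(_ x)[ex]] := fP; case: (pendant e x); case: (pendant e (f x)) => //= _.
  rewrite -leqNgt ltn_neqAle; case: eqP => //= rE; have xE := enum_rank_inj (ord_inj rE).
  by rewrite xE e_irr in ex.
have L_pendant x : x \in L -> pendant e x by rewrite inE => /andP[].
have L_f x : x \in L -> f x \notin L.
  rewrite !inE fK => /andP[-> /=]; case: (pendant e (f x)) => //=.
  by rewrite -leqNgt => /ltnW.
(* The only neighbour of [x] in [L] is [f x], which lies outside [L] and determines [x]; hence no
   two members are adjacent or share a neighbour. *)
have stL : stable (square e) L.
  apply/stableP => x y xL yL; rewrite squareE negb_and negbK.
  have [//|xy /=] := eqVneq x y; rewrite negb_or; apply/andP; split.
    apply/negP => /(pairing_pendant (L_pendant x xL)) yE.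
    by have := L_f x xL; rewrite -yE yL.
  apply/existsP => -[z /andP[exz]]; rewrite e_sym => eyz; case/negP: xy; apply/eqP.
  apply: (inv_inj fK).
  rewrite -(pairing_pendant (L_pendant x xL) exz).
  exact: pairing_pendant (L_pendant y yL) eyz.
apply/eqP/esym/anti_leq/andP; split.
  have [S /andP[stS /eqP <-]] := maximum_stable_exists (square e).
  apply/alpha_ge/stableP => x y xS yS; apply/negP => exy.
  have /stableP/(_ x y xS yS) := stS; rewrite squareE exy orTb andbT negbK.
  by move=> /eqP xy; rewrite xy e_irr in exy.
rewrite -(leq_pmul2r (isT : 0 < 2)) pairing_alpha -L_half leq_pmul2r //.
exact: alpha_ge.
Qed.

(** With no two pendant vertices adjacent, each pair has exactly one pendant end. A vertex [x] is
    not in the core because a maximal stable set through [f x] is maximum and omits [x]. *)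
Lemma pairing_pendant_core :
  (forall x y, pendant e x -> pendant e y -> ~~ e x y) ->
  Konig_Egervary_pendant_core e.
Proof.
move=> stP; apply/and3P; split; first exact: pairing_Konig_Egervary.
  rewrite -(eqn_pmul2r (isT : 0 < 2)) pairing_alpha pairing_half // => x.
  rewrite !inE; have [_ /(_ x)[ex]] := fP.
  have := stP x (f x); rewrite ex.
  by case: (pendant e x); case: (pendant e (f x)) => //= /(_ isT isT).
apply/eqP/setP => x; rewrite inE; apply/bigcapP => /= inS.
have st : stable e [set f x] by apply/stableP => y z /set1P-> /set1P->; rewrite e_irr.
have [S mS] := maximal_stable_in_exists st (subsetT _).
rewrite sub1set (pairing_maximal _ mS) => /negP; apply; apply: inS.
exact: pairing_maximal_maximum.
Qed.

End Pairing.

(** The chosen partner is involutive: if [f x] is pendant, its only neighbour is [x]; otherwise [x]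
    and [f (f x)] are both pendant at [f x], hence equal. *)
Lemma pairing_of_pendant_neighbours :
  (forall x, exists2 y, e x y & pendant e x || pendant e y) ->
  (forall l l' s, pendant e l -> pendant e l' -> e l s -> e l' s -> l = l') ->
  exists f, pendant_pairing f.
Proof.
move=> mate uniq_leaf.
pose f x := odflt x [pick y | e x y && (pendant e x || pendant e y)].
have fP x : e x (f x) /\ (pendant e x || pendant e (f x)).
  rewrite /f; case: pickP => [y /andP[]// | none].
  by have [y exy py] := mate x; have := none y; rewrite /= exy py.
exists f; split=> // x.
have eq_nbr p y z : pendant e p -> e p y -> e p z -> y = z.
  by move=> /pendantP[w _ N] /N-> /N->.
have [ex /orP[px|pf]] := fP x; have [efx pfx] := fP (f x).
  have [pf|npf] := boolP (pendant e (f x)).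
    by apply: eq_nbr pf efx _; exact: adjC.
  move: pfx; rewrite (negPf npf) /= => pff.
  by apply: uniq_leaf pff px _ ex; exact: adjC.
by apply: eq_nbr pf efx _; exact: adjC.
Qed.

Lemma pendant_leaf x y : pendant e x -> e x y -> leaf setT x y.
Proof.
by move=> /pendantP[z _ N] exy; split=> // t _ /N->; rewrite (N y).
Qed.

Lemma leaf_pendant x y : leaf setT x y -> pendant e x.
Proof. by move=> [_ _ exy N]; apply/pendantP; exists y => // z; exact: N. Qed.

(** * Pendant pairings from conditions (iv) and (v) in connected graphs *)

Section Connected.
Hypothesis e_conn : connected e.

Lemma connected_closed (S : {set T}) x : x \in S ->
  (forall y z, y \in S -> e y z -> z \in S) -> forall y, y \in S.
Proof.
move=> xS clS y; rewrite -(closed_connect _ (e_conn x y)) //.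
apply: intro_closed; first exact: sym_connect_sym.
by move=> a b eab aS; exact: clS aS eab.
Qed.

Lemma isolated_isomorphic x : (forall y, ~~ e x y) ->
  isomorphic e (@complete_graph 1).
Proof.
move=> iso; have T1 y : y = x.
  apply/set1P; apply: (connected_closed (set11 x)) => a b /set1P->.
  by rewrite (negPf (iso b)).
exists (fun _ => ord0) => [|y z].
  by exists (fun _ => x) => [y|i]; rewrite ?T1 ?ord1.
by rewrite /complete_graph eqxx (T1 y) (T1 z) e_irr.
Qed.

(** The pair is closed under adjacency, so connectivity makes it the whole vertex set. *)
Lemma adjacent_pendants x y : pendant e x -> pendant e y -> e x y ->
  forall z, z = x \/ z = y.
Proof.
move=> /pendantP[x' _ Nx] /pendantP[y' _ Ny] exy z; apply/set2P.
apply: (connected_closed (set21 x y)) => a b /set2P[->|->].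
  by move=> /Nx->; rewrite -(Nx y) // set22.
by move=> /Ny->; rewrite -(Ny x) ?set21 // adjC.
Qed.

Lemma adjacent_pendants_isomorphic x y : pendant e x -> pendant e y -> e x y ->
  isomorphic e (@complete_graph 2).
Proof.
move=> px py exy; have T2 := adjacent_pendants px py exy.
have xy : y != x by apply: contraTneq exy => ->; rewrite e_irr.
have i2 (i : 'I_2) : i = ord0 \/ i = ord_max.
  by case: i => -[|[|//]] i; [left | right]; exact: val_inj.
exists (fun z => if z == x then ord0 else ord_max).
  exists (fun i => if i == ord0 then x else y) => [z|i].
    by have [->|->] := T2 z; rewrite ?eqxx // (negPf xy).
  by have [->|->] := i2 i; rewrite /= ?eqxx ?(negPf xy).
move=> a b; rewrite /complete_graph.
by have [->|->] := T2 a; have [->|->] := T2 b;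
  rewrite ?eqxx ?(negPf xy) ?e_irr ?exy // e_sym exy.
Qed.

Lemma pendant_core_pairing :
  Konig_Egervary_pendant_core e -> exists f, pendant_pairing f.
Proof.
move=> /and3P[KE /eqP cP /eqP core0]; set P := [set x | _] in cP.
(* Two adjacent pendant vertices would be all of [T], so [#|T|] would equal [alpha e] and the whole
   vertex set would be stable. *)
have stP : stable e P.
  apply/stableP => x y; rewrite !inE => px py; apply/negP => exy.
  have T2 := adjacent_pendants px py exy.
  have PT : P = setT by apply/setP => z; rewrite !inE; have [->|->] := T2 z.
  have [S /andP[/stableP stS /eqP]] := maximum_stable_exists e.
  rewrite -cP PT => cS; have ST : S = setT.
    by apply/eqP; rewrite eqEcard subsetT cS leqnn.
  by have := stS x y; rewrite ST !inE exy => /(_ isT isT).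
have mP : maximum_stable e P by rewrite /maximum_stable stP cP eqxx.
have [g _ gP] := Konig_Egervary_matched KE mP.
apply: pairing_of_pendant_neighbours => [x | l l' s pl pl' els el's].
  have [px|npx] := boolP (pendant e x).
    by have /pendantP[y exy _] := px; exists y.
  have [|gxP exg] := gP x; first by rewrite inE.
  by exists (g x) => //; rewrite inE in gxP.
apply/eqP/contraT => ll'.
(* The empty core supplies a maximum stable set avoiding [l]. It must contain [s], the only
   neighbour of [l], and swapping [s] for [l] and [l'] enlarges it. *)
have [S /andP[stS /eqP aS] lS] : exists2 S, maximum_stable e S & l \notin S.
  apply/exists_inP; rewrite -negb_forall_in; apply/negP => /forall_inP inS.
  by have : l \in core e by [apply/bigcapP => S /inS]; rewrite core0 inE.
have sS : s \in S.
  apply/contraT => sS; have : stable e (l |: S).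
    apply: stableU1 => // y yS; apply/negP => ely.
    by have /pendantP[z _ N] := pl; rewrite (N s) // -(N y) // yS in sS.
  by move=> /alpha_ge; rewrite cardsU1 lS add1n aS ltnn.
have [st' _ cS'] := leaf_swap (pendant_leaf pl els) (pendant_leaf pl' el's)
  ll' stS (subsetT S) sS.
by have := alpha_ge st'; rewrite cS' aS ltnn.
Qed.

Hypothesis notK1 : ~ isomorphic e (@complete_graph 1).

Lemma neighbour_exists x : exists y, e x y.
Proof.
have [y exy | none] := pickP (e x); first by exists y.
by case: notK1; apply: (@isolated_isomorphic x) => y; rewrite none.
Qed.

Lemma square_stable_pairing :
  Konig_Egervary e -> square_stable e -> exists f, pendant_pairing f.
Proof.
move=> KE /eqP sqst.
have [S /andP[/stableP stS /eqP aS]] := maximum_stable_exists (square e).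
have nbrS x y z : x \in S -> y \in S -> e x z -> e y z -> x = y.
  move=> xS yS exz eyz; apply/eqP/contraT => xy; have := stS x y xS yS.
  rewrite squareE xy negb_or negb_exists => /andP[_ /forallP/(_ z)].
  by rewrite exz adjC.
have adjS x y : x \in S -> e x y -> y \notin S.
  move=> xS exy; apply/negP => yS; have := stS x y xS yS.
  by rewrite squareE exy orTb andbT negbK => /eqP xy; rewrite xy e_irr in exy.
have mS : maximum_stable e S.
  rewrite /maximum_stable aS sqst eqxx andbT; apply/stableP => x y xS yS.
  by apply/negP => /(adjS x y xS); rewrite yS.
have [g g_inj gP] := Konig_Egervary_matched KE mS.
(* A vertex outside [S] has at most one neighbour in [S], as [S] is stable in the square. So [g]
   sends all neighbours of [x] to [x], and injectivity of [g] makes [x] pendant. *)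
have gS x y : x \in S -> e x y -> g y = x.
  move=> xS exy; have [gyS ey] := gP y (adjS x y xS exy).
  by apply: (nbrS _ _ y) => //; exact: adjC.
have pS x : x \in S -> pendant e x.
  move=> xS; have [y exy] := neighbour_exists x; apply/pendantP; exists y => // z exz.
  by apply: g_inj; rewrite ?inE ?(gS x) // (adjS x).
apply: pairing_of_pendant_neighbours => [x | l l' s pl pl' els el's].
  have [xS|xS] := boolP (x \in S).
    by have [y exy] := neighbour_exists x; exists y; rewrite // pS.
  by have [gxS exg] := gP x xS; exists (g x); rewrite // (pS (g x)) // orbT.
(* If [l] is outside [S], its only neighbour [s] is [g l], which lies in [S] and is pendant; thus
   [l] and [l'] are both the neighbour of [s]. *)
have [lS|lS] := boolP (l \in S); last first.
  have [glS elg] := gP l lS; have /pendantP[z _ Nl] := pl.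
  have /pendantP[t _ Ns] : pendant e s by rewrite (Nl s) // -(Nl (g l)) // pS.
  by rewrite (Ns l) 1?(Ns l') // adjC.
have [l'S|l'S] := boolP (l' \in S); first exact: nbrS lS l'S els el's.
have [glS elg] := gP l' l'S; have /pendantP[z _ Nl] := pl'.
have /pendantP[t _ Ns] : pendant e s by rewrite (Nl s) // -(Nl (g l')) // pS.
by rewrite (Ns l) 1?(Ns l') // adjC.
Qed.

End Connected.

(** * Local structure of well-covered graphs of girth at least 6 *)

Section LargeGirth.
(** The girth condition is used as the absence of short closed walks. A closed walk of length 4 may
    retrace its edges, hence the two inequalities in [no4]. *)
Hypotheses (no3 : forall a b c, e a b -> e b c -> e c a -> False).
Hypotheses (no4 : forall a b c d, a != c -> b != d ->
  e a b -> e b c -> e c d -> e d a -> False).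
Hypotheses (no5 : forall a b c d f,
  e a b -> e b c -> e c d -> e d f -> e f a -> False).

Definition nbr2 (A : {set T}) (x a b : T) : Prop :=
  [/\ x \in A, a \in A /\ b \in A, a != b, e x a /\ e x b &
      forall z, z \in A -> e x z -> z = a \/ z = b].

(* [x] lies on a 7-cycle which is a connected component of [A]; the cycle is
   traversed by a 7-periodic sequence. *)
Definition C7_component (A : {set T}) (x : T) : Prop :=
  exists c : nat -> T, [/\ c 0 = x, forall i, c (i + 7) = c i &
    forall i, nbr2 A (c i.+1) (c i) (c i.+2)].

Definition pendant_paired (A : {set T}) (x : T) : Prop :=
  exists y, leaf A x y \/ leaf A y x.

Definition good (A : {set T}) (x : T) : Prop :=
  [\/ forall y, y \in A -> ~~ e x y, pendant_paired A x | C7_component A x].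

Lemma C7_shift (A : {set T}) c k : (forall i, c (i + 7) = c i) ->
  (forall i, nbr2 A (c i.+1) (c i) (c i.+2)) -> C7_component A (c k).
Proof.
move=> per Nc; exists (fun i => c (i + k)); split=> // i; last exact: (Nc (i + k)).
by rewrite addnAC per.
Qed.

Lemma C7_nbr2 (A : {set T}) x : C7_component A x -> exists a b,
  [/\ nbr2 A x a b, C7_component A a & C7_component A b].
Proof.
move=> [c [<- per Nc]]; exists (c 6), (c 1); split; try exact: C7_shift.
by have := Nc 6; rewrite (per 0) (per 1).
Qed.

Lemma C7_adj (A : {set T}) x y : C7_component A x -> e x y -> y \in A -> C7_component A y.
Proof.
move=> /C7_nbr2[a [b [[_ _ _ _ Nx] ca cb]]] exy yA.
by have [->|->] := Nx y yA exy.
Qed.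

Lemma C7_not_leaf (A : {set T}) x y : C7_component A x -> ~ leaf A x y.
Proof.
move=> /C7_nbr2[a [b [[_ [aA bA] ab [exa exb] _] _ _]]] [_ _ _ Nx].
by rewrite (Nx a) // (Nx b) // eqxx in ab.
Qed.

Lemma C7_intro (A : {set T}) c0 c1 c2 c3 c4 c5 c6 :
  nbr2 A c0 c6 c1 -> nbr2 A c1 c0 c2 -> nbr2 A c2 c1 c3 -> nbr2 A c3 c2 c4 ->
  nbr2 A c4 c3 c5 -> nbr2 A c5 c4 c6 -> nbr2 A c6 c5 c0 -> C7_component A c0.
Proof.
move=> N0 N1 N2 N3 N4 N5 N6.
exists (fun i => nth c0 [:: c0; c1; c2; c3; c4; c5; c6] (i %% 7)); split=> // i.
  by rewrite modnDr.
rewrite -(addn2 i) -(addn1 i) -(modnDml i 1) -(modnDml i 2).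
have : i %% 7 < 7 by rewrite ltn_mod.
by case: (i %% 7) => [|[|[|[|[|[|[|]]]]]]].
Qed.


Lemma no_triangle_edge a b c : e a b -> e b c -> ~~ e c a.
Proof. by move=> ab bc; apply/negP => /(no3 ab bc). Qed.

Lemma adj_neq x y : e x y -> x != y.
Proof. by apply: contraTneq => ->; rewrite e_irr. Qed.

(** * Induction step when [A] has a leaf *)

Section InductionStep.
Variable A : {set T}.
Hypothesis wcA : well_covered_in A.
Hypothesis IH : forall z x, z \in A -> x \in delN A z -> good (delN A z) x.

Lemma delN_leaf_unique z l l' s : z \in A ->
  leaf (delN A z) l s -> leaf (delN A z) l' s -> l = l'.
Proof. by move=> /well_covered_delN/(_ wcA)/leaf_unique; apply. Qed.

Lemma good_of_leaf l s x : leaf A l s -> x \in A -> good A x.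
Proof.
move=> ls xA; have [lA sA els Nl] := ls.
have [->|xl] := eqVneq x l; first by apply: Or32; exists s; left.
have [->|xs] := eqVneq x s; first by apply: Or32; exists l; right.
(* Deleting [N[l]] removes exactly [l] and [s]. *)
have delP y : y \in A -> y != s -> y != l -> y \in delN A l.
  move=> yA ys yl; rewrite in_delN yA yl /=; apply/negP => /(Nl _ yA) ys'.
  by rewrite ys' eqxx in ys.
have sNdel : s \notin delN A l by rewrite in_delN els !andbF.
have lNdel : l \notin delN A l by rewrite in_delN eqxx !andbF.
have leaf_l z : z \in A -> ~~ e z s -> z != l -> z != s -> leaf (delN A z) l s.
  move=> zA nezs zl zs; split=> //; last by move=> w /delN_sub; exact: Nl.
  - rewrite in_delN lA eq_sym zl /=; apply/negP; rewrite e_sym => /(Nl _ zA) zs'.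
    by rewrite zs' eqxx in zs.
  - by rewrite in_delN sA eq_sym zs.
(* A pendant edge of [A - N[l]] stays pendant in [A]. Only the case where the leaf [a] is adjacent
   to [s] is delicate: either [b] then has no neighbour but [a], or it has another one, [c]. *)
have back a b : leaf (delN A l) a b -> pendant_paired A a /\ pendant_paired A b.
  move=> [aB bB eab Na]; have aA := delN_sub aB; have bA := delN_sub bB.
  have nl y : y \in delN A l -> y != l by apply: contraTneq => ->.
  have ns y : y \in delN A l -> y != s by apply: contraTneq => ->.
  have nel y : y \in delN A l -> ~~ e y l by rewrite in_delN e_sym => /and3P[].
  have [eas|neas] := boolP (e a s); last first.
    have lab : leaf A a b.
      split=> // z zA eaz; apply: Na => //; apply: delP => //.
        by apply: contraNneq neas => <-.
      by apply: contraNneq (nel a aB) => <-.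
    by split; [exists b; left | exists a; right].
  have nebs := no_triangle_edge (adjC eas) eab.
  have [c /and3P[cA ebc ca] | noc] := pickP [pred c | [&& c \in A, e b c & c != a]].
    have cb : c != b by rewrite eq_sym adj_neq.
    have nes : ~~ e c s.
      apply/negP => ecs; apply: (@no4 a b c s) => //; first by rewrite eq_sym.
      - exact: ns.
      - exact: adjC.
    have cl : c != l by apply: contraNneq (nel b bB) => <-.
    have cs : c != s by apply: contraNneq nebs => <-.
    (* Deleting [N[c]] removes [b], so [a] becomes a second leaf at [s] beside [l]. *)
    have asleaf : leaf (delN A c) a s.
      split=> //.
      - by rewrite in_delN aA eq_sym ca (no_triangle_edge eab).
      - by rewrite in_delN sA eq_sym cs.
      move=> z; rewrite in_delN => /and3P[zA zc necz] eaz.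
      have [//|zs] := eqVneq z s; case/negP: necz.
      have zB : z \in delN A l.
        by apply: delP => //; apply: contraNneq (nel a aB) => <-.
      by rewrite (Na z zB eaz) e_sym.
    have al := delN_leaf_unique cA asleaf (leaf_l c cA nes cl cs).
    by move: (nl a aB); rewrite al eqxx.
  have lba : leaf A b a.
    split=> //; first exact: adjC.
    move=> z zA ebz; apply/eqP; have := noc z; rewrite /= zA ebz /=.
    by move/negbFE.
  by split; [exists b; right | exists a; left].
have xB := delP x xA xs xl.
have [iso | [y [/back[? _]|/back[_ ?]]] | cx] := IH lA xB; try exact: Or32.
  (* A vertex isolated in [A - N[l]] can only have [s] as a neighbour in [A]. *)
  have exs z : z \in A -> e x z -> z = s.
    move=> zA exz; apply/eqP/contraT => zs.
    have zl : z != l.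
      by apply: contraNneq xs => zl; apply/eqP/Nl; rewrite // -zl e_sym.
    by rewrite (negPf (iso z _)) // in exz; exact: delP.
  have [/forall_inP noadj | ] := boolP [forall y in A, ~~ e x y]; first exact: Or31.
  rewrite negb_forall_in => /exists_inP[z zA]; rewrite negbK => exz.
  apply: Or32; exists s; left; split=> //; rewrite -(exs z) //.
(* If [c 0] were adjacent to [s], deleting [N[c 2]] and [N[c 5]] would remove [c 1] and [c 6] but
   keep [s], making [c 0] and [l] two leaves at [s]. *)
have Ncs y : C7_component (delN A l) y -> ~~ e y s.
  move=> [c [<- per Nc]]; apply/negP => e0s.
  have := Nc 6; rewrite (per 0) (per 1) => - [B0 [B6 B1] n61 [e06 e01] N0].
  have [_ [_ B2] n02 [_ e12] N1] := Nc 0.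
  have [_ [_ B3] n13 [_ e23] N2] := Nc 1.
  have [_ [_ B4] n24 [_ e34] N3] := Nc 2.
  have [_ [_ B5] n35 [_ e45] N4] := Nc 3.
  have := Nc 4; have := Nc 5; rewrite (per 0).
  move=> [_ _ n50 [e65 e60] N6] [_ _ n46 [e54 e56] N5].
  have ns z : z \in delN A l -> z != s by apply: contraTneq => ->.
  have nl z : z \in delN A l -> z != l by apply: contraTneq => ->.
  have nel z : z \in delN A l -> ~~ e z l by rewrite in_delN e_sym => /and3P[].
  have n2s : ~~ e (c 2) s.
    apply/negP => e2s; apply: (@no4 s (c 0) (c 1) (c 2)); rewrite // 1?e_sym //.
    by rewrite eq_sym ns.
  have n5s : ~~ e (c 5) s.
    apply/negP => e5s; apply: (@no4 s (c 0) (c 6) (c 5)); rewrite // 1?e_sym //.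
    - by rewrite eq_sym ns.
    - by rewrite eq_sym.
  have n20 : ~~ e (c 2) (c 0) by apply: no_triangle_edge e01 e12.
  have n5e0 : ~~ e (c 5) (c 0) by apply: no_triangle_edge e06 e65.
  have n25 : ~~ e (c 2) (c 5).
    apply/negP => /(N2 _ B5)[] n5; last by rewrite n5 eqxx in n35.
    by rewrite n5 in e65; apply: (no3 e06 e65); rewrite e_sym.
  have d25 : c 5 != c 2.
    by apply: contraTneq e45 => ->; exact: no_triangle_edge e23 e34.
  have sd2 : s \in delN A (c 2) by rewrite in_delN sA eq_sym ns.
  have d2 z : z \in delN A l -> z \in A by apply: delN_sub.
  have c5d : c 5 \in delN A (c 2) by rewrite in_delN d2 // d25.
  pose D := delN (delN A (c 2)) (c 5).
  have sD : s \in D by rewrite in_delN sd2 eq_sym ns.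
  have wcD : well_covered_in D.
    by apply: well_covered_delN => //; apply: well_covered_delN => //; exact: d2.
  have n2l : ~~ e (c 2) l by exact: nel.
  have lD : leaf D l s.
    split=> //; last by move=> z /delN_sub/delN_sub; exact: Nl.
    by rewrite !in_delN lA n2l ![l == _]eq_sym !nl // nel.
  have cD : leaf D (c 0) s.
    split=> //.
      rewrite !in_delN d2 // n20 n5e0 n02 andbT /=.
      by rewrite eq_sym n50.
    move=> z; rewrite !in_delN => /and3P[/and3P[zA _ nz2] _ nz5] e0z.
    apply/eqP/contraT => zs.
    have [|zE|zE] := N0 z _ e0z.
    - by apply: delP => //; apply: contraTneq e0z => ->; exact: nel.
    - by rewrite zE e56 in nz5.
    - by rewrite zE e_sym e12 in nz2.
  by have := leaf_unique wcD lD cD => lc; have := nl _ B0; rewrite -lc eqxx.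
(* Neither [l] nor [s] is adjacent to the cycle, so it is still a component in [A]. *)
case: cx => c [c0 per Nc].
apply: Or33; exists c; split=> // i; have [ciB [aB bB] ab adj Ni] := Nc i.
split=> //; first exact: delN_sub ciB.
  by split; [exact: delN_sub aB | exact: delN_sub bB].
move=> z zA ez; apply: Ni => //; apply: delP => //.
  by apply: contraTneq ez => ->; apply: Ncs; exact: C7_shift.
by apply: contraTneq ez => ->; move: ciB; rewrite in_delN e_sym => /and3P[].
Qed.

Hypothesis noleaf : forall x y, ~ leaf A x y.

Lemma other_neighbour x y : x \in A -> y \in A -> e x y ->
  exists z, [/\ z \in A, e x z & z != y].
Proof.
move=> xA yA exy.
have [z /and3P[zA exz zy] | noz] := pickP [pred z | [&& z \in A, e x z & z != y]].
  by exists z.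
case: (@noleaf x y); split=> // z zA exz; apply/eqP.
by have := noz z; rewrite /= zA exz /= => /negbFE.
Qed.

(** * Induction step when [A] has no leaf but some [A - N[v]] has one *)

Section LeafOfDeletion.
Variable v : T.
Hypothesis vA : v \in A.
Let B := delN A v.

Let B_A z : z \in B -> z \in A. Proof. exact: delN_sub. Qed.
Let B_nadj z : z \in B -> ~~ e v z. Proof. by rewrite in_delN => /and3P[]. Qed.
Let B_neq z : z \in B -> z != v. Proof. by rewrite in_delN => /and3P[]. Qed.
Let neqB u z : e v u -> z \in B -> u != z.
Proof. by move=> evu /B_nadj; apply: contraNneq => <-. Qed.

(* [l], [s] is a pendant edge of [A - N[v]], with [l] the leaf, and [u] is the
   second neighbour of [l] in [A]. *)
Definition attached_edge (s l u : T) : Prop :=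
  [/\ s \in B, l \in B, u \in A /\ e v u, nbr2 A l u s &
      forall z, z \in A -> e s z -> z \in B].

Lemma attached_leaf s l u : attached_edge s l u -> leaf B l s.
Proof.
move=> [sB lB [uA evu] [_ _ _ [_ els] Nl] _]; split=> // z zB elz.
by have [zu|] := Nl z (B_A zB) elz; first by have := neqB evu zB; rewrite zu eqxx.
Qed.

Lemma leaf_attached s l : leaf B l s -> exists u, attached_edge s l u.
Proof.
move=> [lB sB els Nl].
have [u [uA elu us]] := other_neighbour (B_A lB) (B_A sB) els.
have vE z : z \in A -> e l z -> z != s -> e v z.
  move=> zA elz zs; apply/contraT => nevz; move: zs; rewrite (Nl z) ?eqxx //.
  rewrite in_delN zA nevz andbT; apply: contraTneq elz => ->.
  by rewrite e_sym B_nadj.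
have evu := vE u uA elu us.
exists u; split=> //.
  split=> //; [exact: B_A | by split=> //; exact: B_A |].
  move=> z zA elz; have [|zs] := eqVneq z s; first by right.
  have [|zu] := eqVneq z u; first by left.
  exfalso; apply: (@no4 v u l z) => //.
  - by rewrite eq_sym B_neq.
  - by rewrite eq_sym.
  - exact: adjC.
  - by apply: adjC; exact: vE.
move=> z zA esz; rewrite in_delN zA /=; apply/andP; split.
  by apply: contraTneq esz => ->; rewrite e_sym B_nadj.
apply/negP => evz; apply: (@no5 v u l s z) => //; exact: adjC.
Qed.

(** By the induction hypothesis at [s'] in [A - N[v]]: were [s'] a leaf, it would be a second leaf
    at [s]; a C7 through [s'] would contain the leaf [l]. *)
Lemma attached_next s l u s' : attached_edge s l u -> s' \in A -> e s s' ->
  s' != l -> exists l' u', attached_edge s' l' u'.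
Proof.
move=> St s'A ess' s'l; have ls := attached_leaf St.
have [sB lB _ [_ _ _ [_ els] _] Ns] := St; have s'B := Ns s' s'A ess'.
have [/(_ s sB) | [y [s'y | /leaf_attached[u' ?]]] | c7] := IH vA s'B.
- by rewrite e_sym ess'.
- have [_ _ _ /(_ s sB)] := s'y; rewrite e_sym => /(_ ess') sy.
  rewrite -sy in s'y; rewrite (delN_leaf_unique vA s'y ls) eqxx in s'l => //.
- by exists y, u'.
- by case: (C7_not_leaf (C7_adj (C7_adj c7 (adjC ess') sB) (adjC els) lB) ls).
Qed.

Lemma attached_neq s l u s' l' u' : attached_edge s l u ->
  attached_edge s' l' u' -> e s s' -> s' != l -> l' != s.
Proof.
move=> [_ lB _ [_ _ _ [_ els] _] _] /attached_leaf[_ _ _ Nl'] ess'.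
by apply: contraNneq => l's; rewrite (Nl' l lB) // l's adjC.
Qed.

Lemma attached_other s l u : attached_edge s l u ->
  exists s' l' u', [/\ attached_edge s' l' u', e s s' & s' != l].
Proof.
move=> St; have [sB lB _ [_ _ _ [_ els] _] _] := St.
have [s' [s'A ess' s'l]] := other_neighbour (B_A sB) (B_A lB) (adjC els).
by have [l' [u' St']] := attached_next St s'A ess' s'l; exists s', l', u'.
Qed.

Lemma attached_in_delN s l u s' l' u' : attached_edge s l u ->
  attached_edge s' l' u' -> [/\ v \in delN A s, u' \in delN A s &
    s' != s -> l' != s -> l' \in delN A s].
Proof.
move=> [sB _ _ _ Ns] [s'B l'B [u'A evu'] [_ _ _ [el'u' el's'] Nl'] _].
split.
- by rewrite in_delN vA eq_sym B_neq // e_sym B_nadj.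
- rewrite in_delN u'A neqB //=; apply/negP => /(Ns _ u'A)/B_nadj.
  by rewrite evu'.
move=> s's l's; rewrite in_delN B_A // l's /= e_sym; apply/negP => /Nl'.
case=> [|su'|ss']; first exact: B_A.
  by have := neqB evu' sB; rewrite su' eqxx.
by rewrite ss' eqxx in s's.
Qed.

(** In [A - N[s]] the vertex [l2] is a leaf at [u2]. The induction hypothesis at [v] then leaves
    only a leaf [y] at [v], since the other cases conflict with that leaf; [y] turns out to be
    [u]. *)
Lemma attached_u_nbr s l u : attached_edge s l u -> nbr2 A u v l.
Proof.
move=> St; have [sB lB [uA evu] [_ _ us [elu els] Nl] Ns] := St.
have [s2 [l2 [u2 [St2 ess2 s2l]]]] := attached_other St.
have [s2B l2B [u2A evu2] [_ _ _ [el2u2 el2s2] Nl2] _] := St2.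
have l2s := attached_neq St St2 ess2 s2l.
have s2s : s2 != s by rewrite eq_sym adj_neq.
have [vD u2D /(_ s2s l2s) l2D] := attached_in_delN St St2.
have sA := B_A sB.
have l2leaf : leaf (delN A s) l2 u2.
  split=> // z; rewrite in_delN => /and3P[zA _ nesz] /(Nl2 _ zA)[//|zs2].
  by rewrite zs2 ess2 in nesz.
have nbrs z : z \in A -> e u z -> e s z -> z = l.
  move=> zA euz esz; apply/eqP/contraT => zl.
  have [l' [u' [_ _ _ _ /(_ u uA)]]] := attached_next St zA esz zl.
  by rewrite e_sym => /(_ euz)/B_nadj; rewrite evu.
have neus : ~~ e u s.
  by apply/negP; rewrite e_sym => /(Ns _ uA)/B_nadj; rewrite evu.
suff leafu : leaf (delN A s) u v.
  split=> //; [by split=> //; exact: B_A | by rewrite eq_sym B_neq |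
    by split; exact: adjC |].
  have [_ _ _ Nu] := leafu.
  move=> z zA euz; have [zD|] := boolP (z \in delN A s); first by left; exact: Nu.
  rewrite in_delN zA /= negb_and !negbK => /orP[/eqP zs|esz].
    by rewrite zs (negPf neus) in euz.
  by right; exact: nbrs.
have [/(_ u2 u2D) | [y [vy | yv]] | c7] := IH sA vD.
- by rewrite evu2.
- have [_ _ _ /(_ u2 u2D evu2) u2y] := vy; rewrite -u2y in vy.
  have := B_neq l2B; rewrite -(delN_leaf_unique sA vy l2leaf) eqxx => //.
(* A neighbour [w] of [y] other than [v] must have been deleted, so it is adjacent to [s]. If [w] is
   [l], then [y] is [u]; otherwise all neighbours of [w] lie in [B], but [y] does not. *)
- have [yD _ eyv Ny] := yv; have yA := delN_sub yD.
  have [w [wA eyw wv]] := other_neighbour yA vA eyv.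
  have yNB : y \notin B by rewrite in_delN (adjC eyv) !andbF.
  have esw : e s w.
    apply/contraT => nesw; rewrite (Ny w) ?eqxx // in wv.
    rewrite in_delN wA nesw andbT; apply: contraTneq eyw => ->.
    by apply: contra yNB; rewrite e_sym; exact: Ns.
  have [wl|wl] := eqVneq w l.
    rewrite wl in eyw; have [<- //|ys] := Nl y yA (adjC eyw).
    by rewrite ys sB in yNB.
  have [l' [u' [_ _ _ _ /(_ y yA)]]] := attached_next St wA esw wl.
  by rewrite e_sym (negPf yNB) => /(_ eyw).
- case: (C7_not_leaf _ l2leaf); apply: C7_adj (adjC el2u2) l2D.
  exact: C7_adj c7 evu2 u2D.
Qed.

(** With two further neighbours [s2] and [s3], deleting [N[s2]] makes [u2] a leaf at [v], while the
    path [v], [u3], [l3], [s3] survives. Then [u3] is neither a leaf nor next to one, and a C7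
    through it would contain [u2]. *)
Lemma attached_s_nbr s l u s2 s3 : attached_edge s l u ->
  s2 \in A -> s3 \in A -> e s s2 -> e s s3 -> s2 != l -> s3 != l -> s2 = s3.
Proof.
move=> St s2A s3A ess2 ess3 s2l s3l; apply/eqP/contraT => s23.
have [l2 [u2 St2]] := attached_next St s2A ess2 s2l.
have [l3 [u3 St3]] := attached_next St s3A ess3 s3l.
have [s2B l2B [u2A evu2] [_ _ _ [el2u2 el2s2] Nl2] _] := St2.
have [s3B l3B [u3A evu3] [_ _ u3s3 [el3u3 el3s3] Nl3] _] := St3.
have [_ _ _ _ Nu2] := attached_u_nbr St2.
have [_ _ _ _ Nu3] := attached_u_nbr St3.
have s3s2 : s3 != s2 by rewrite eq_sym.
have [sB _ _ _ _] := St; have sA := B_A sB.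
have l3s2 : l3 != s2.
  apply: contraTneq ess3 => l3s2; have [_ _ _ Nl] := attached_leaf St3.
  by rewrite -(Nl s) ?e_irr // l3s2 adjC.
have [vD u3D /(_ s3s2 l3s2) l3D] := attached_in_delN St2 St3.
have [_ u2D _] := attached_in_delN St2 St2.
have s3D : s3 \in delN A s2.
  by rewrite in_delN s3A s3s2 (no_triangle_edge (adjC ess3) ess2).
have u2leaf : leaf (delN A s2) u2 v.
  split=> //; first exact: adjC.
  move=> z; rewrite in_delN => /and3P[zA _ nes2z] /(Nu2 _ zA)[//|zl2].
  by rewrite zl2 adjC in nes2z.
have l2l3 : l2 != l3.
  apply: contraNneq s23 => l23; have [_ _ _ Nl] := attached_leaf St2.
  by rewrite -(Nl s3) // l23.
have u2u3 : u2 != u3.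
  apply: contraNneq l2l3 => u23; have [||l2v|->//] := Nu3 l2; first exact: B_A.
    by rewrite -u23 adjC.
  by have := B_neq l2B; rewrite l2v eqxx.
have [/(_ v vD) | [y [[_ _ _ Ny] | [yD _ eyu3 Ny]]] | c7] := IH s2A u3D.
- by rewrite adjC.
- have := B_neq l3B; rewrite (Ny v) // 1?adjC // (Ny l3) ?eqxx //; exact: adjC.
- have [yv|yl3] := Nu3 y (delN_sub yD) (adjC eyu3).
    by rewrite (Ny u2) ?yv ?eqxx in u2u3.
  by rewrite (Ny s3) ?yl3 ?eqxx in u3s3.
- case: (C7_not_leaf _ u2leaf); apply: C7_adj evu2 u2D.
  by apply: C7_adj c7 (adjC evu3) vD.
Qed.

Lemma leaf_delN_C7 l s : leaf B l s -> C7_component A v.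
Proof.
move=> /leaf_attached[u St]; have Nu := attached_u_nbr St.
have [s2 [l2 [u2 [St2 ess2 s2l]]]] := attached_other St.
have [sB lB [uA evu] Nl _] := St; have [_ _ us [elu els] Nl'] := Nl.
have [s2B l2B [u2A evu2] Nl2 _] := St2; have [_ _ u2s2 [el2u2 el2s2] Nl2'] := Nl2.
have Nu2 := attached_u_nbr St2; have [_ _ _ _ Nu2'] := Nu2.
have l2s := attached_neq St St2 ess2 s2l.
have nbr2C x a b : nbr2 A x a b -> nbr2 A x b a.
  move=> [xA [aA bA] ab [exa exb] N]; split=> //; first by rewrite eq_sym.
  by move=> z zA /(N z zA)[]; [right | left].
have Ns : nbr2 A s l s2.
  split; rewrite ?B_A // 1?eq_sym //; first by split; rewrite // adjC.
  move=> z zA esz; have [|zl] := eqVneq z l; first by left.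
  by right; apply: (attached_s_nbr St) => //; exact: B_A.
have Ns2 : nbr2 A s2 s l2.
  split; rewrite ?B_A // 1?eq_sym //; first by split; rewrite // adjC.
  move=> z zA esz; have [|zl2] := eqVneq z l2; first by right.
  left; apply: (attached_s_nbr St2) => //; rewrite ?B_A // 1?eq_sym //.
  exact: adjC.
have l2l : l2 != l.
  apply: contraTneq ess2 => l2l; have [_ _ _ N] := attached_leaf St.
  by rewrite (N s2) ?e_irr // -l2l.
have u2u : u2 != u.
  apply: contraNneq l2l => u2u; have [_ _ _ _ /(_ l2)] := Nu.
  case=> [||l2v|-> //]; first exact: B_A.
    by rewrite -u2u adjC.
  by have := B_neq l2B; rewrite l2v eqxx.
(* The other six vertices of the cycle have degree two by now. For a third neighbour [u4] of [v],
   consider [u2] in [A - N[l]]: its neighbours [v] and [l2] both have degree at least two there, and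
   a C7 through it would contain the leaf [s2]. *)
suff Nv : nbr2 A v u2 u.
  exact: (C7_intro Nv Nu Nl Ns Ns2 (nbr2C _ _ _ Nl2) (nbr2C _ _ _ Nu2)).
split=> // u4 u4A evu4; have [|u42] := eqVneq u4 u2; first by left.
have [|u4u] := eqVneq u4 u; first by right.
exfalso; have lA := B_A lB.
have delP z : z \in A -> z != l -> z != u -> z != s -> z \in delN A l.
  move=> zA zl zu zs; rewrite in_delN zA zl /=; apply/negP => /(Nl' _ zA)[] zE.
    by rewrite zE eqxx in zu.
  by rewrite zE eqxx in zs.
have vD : v \in delN A l by rewrite in_delN vA eq_sym B_neq // e_sym B_nadj.
have u2D : u2 \in delN A l by apply: delP => //; exact: neqB.
have u4D : u4 \in delN A l by apply: delP => //; exact: neqB.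
have s2D : s2 \in delN A l.
  by apply: delP; rewrite ?B_A // eq_sym; [exact: neqB | exact: adj_neq].
have l2D : l2 \in delN A l by apply: delP; rewrite ?B_A // eq_sym neqB.
have s2leaf : leaf (delN A l) s2 l2.
  split=> //; first exact: adjC.
  move=> z zD; have [_ _ _ _ /(_ z (delN_sub zD))N /N[]//] := Ns2.
  by move=> zs; move: zD; rewrite zs in_delN els !andbF.
have [/(_ v vD) | [y [[_ _ _ Ny] | [yD _ eyu2 Ny]]] | c7] := IH lA u2D.
- by rewrite adjC.
- have := B_neq l2B; rewrite (Ny v) // 1?adjC // (Ny l2) ?eqxx //; exact: adjC.
- have [yv|yl2] := Nu2' y (delN_sub yD) (adjC eyu2).
    by rewrite (Ny u4) ?yv ?eqxx in u42.
  by rewrite (Ny s2) ?yl2 ?eqxx in u2s2.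
- case: (C7_not_leaf _ s2leaf); apply: C7_adj el2s2 s2D.
  by apply: C7_adj c7 (adjC el2u2) l2D.
Qed.

End LeafOfDeletion.
End InductionStep.

(** * The classification by induction on [A] *)

Lemma leaf_dec (A : {set T}) :
  (exists x y, leaf A x y) \/ (forall x y, ~ leaf A x y).
Proof.
have [/existsP[x /existsP[y /and4P[xA yA exy /forall_inP N]]] | none] := boolP
  [exists x, exists y, [&& x \in A, y \in A, e x y &
    [forall z in A, e x z ==> (z == y)]]].
  left; exists x, y; split=> // z zA exz.
  by apply/eqP; have /implyP := N z zA; apply.
right=> x y [xA yA exy N]; case/existsP: none; exists x; apply/existsP; exists y.
rewrite xA yA exy; apply/forall_inP => z zA; apply/implyP => exz.
by apply/eqP/N.
Qed.

Lemma well_covered_good (A : {set T}) x :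
  well_covered_in A -> x \in A -> good A x.
Proof.
have [n] := ubnP #|A|; elim: n => // n IHn in A x * => leA wcA xA.
have IH z y : z \in A -> y \in delN A z -> good (delN A z) y.
  move=> zA; apply: IHn; last exact: well_covered_delN.
  rewrite -ltnS; apply: leq_trans leA; rewrite ltnS; apply: proper_card.
  apply/properP; split; last by exists z; rewrite // in_delN eqxx andbF.
  by apply/subsetP => w /delN_sub.
have [[l [s /good_of_leaf]] | noleaf] := leaf_dec A; first exact.
have [u /andP[uA exu] | iso] := pickP [pred u | (u \in A) && e x u]; last first.
  by apply: Or31 => y yA; have /negbT := iso y; rewrite /= yA.
(* Without leaves and with [x] not isolated, there is a vertex [w] at distance two from [x]; it
   survives in [A - N[x]]. *)
have [w [wA euw wx]] := other_neighbour noleaf uA xA (adjC exu).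
have wB : w \in delN A x.
  by rewrite in_delN wA wx e_sym (no_triangle_edge exu euw).
have uNB : u \notin delN A x by rewrite in_delN exu !andbF.
(* A deleted neighbour of [a] would close a 5-cycle [x], [u], [w], [a], [z]. *)
have nbrB a : e w a -> a \in delN A x -> forall z, z \in A -> e a z -> z \in delN A x.
  move=> ewa aB z zA eaz; rewrite in_delN zA /=; apply/andP; split.
    by apply: contraTneq eaz => ->; move: aB; rewrite in_delN e_sym => /and3P[].
  apply/negP => exz; apply: (no5 exu euw ewa eaz); exact: adjC.
apply: Or33; have [iso | [y [] /leaf_delN_C7]| c7] := IH x w xA wB.
- have [z [zA ewz zu]] := other_neighbour noleaf wA uA (adjC euw).
  suff /iso : z \in delN A x by rewrite ewz.
  rewrite in_delN zA /=; apply/andP; split.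
    by apply: contraTneq ewz => ->; exact: no_triangle_edge exu euw.
  apply/negP => exz; apply: (@no4 x u w z) => //.
  - by rewrite eq_sym.
  - by rewrite eq_sym.
  - exact: adjC.
- exact.
- exact.
have [a [b [[_ [aB bB] ab [ewa ewb] _] ca cb]]] := C7_nbr2 c7.
(* Here [a], [w], [b], [d] are consecutive on the C7 of [A - N[x]]; deleting [N[a]] removes [w] and
   leaves [b] as a leaf at [d]. *)
have [d [dB ebd dw Nb]] : exists d, [/\ d \in delN A x, e b d, d != w &
    forall z, z \in delN A x -> e b z -> z = w \/ z = d].
  have [p [q [[_ [pB qB] pq [ebp ebq] Nb] _ _]]] := C7_nbr2 cb.
  have [wp|wq] := Nb w wB (adjC ewb).
    by exists q; rewrite wp eq_sym.
  exists p; rewrite wq; split=> // z zB /(Nb z zB)[]; by [right | left].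
have aA := delN_sub aB.
have bleaf : leaf (delN A a) b d.
  split=> //.
  - by rewrite in_delN (delN_sub bB) eq_sym ab (no_triangle_edge (adjC ewb) ewa).
  - rewrite in_delN (delN_sub dB) /=; apply/andP; split.
      apply: contraTneq ebd => ->; exact: no_triangle_edge (adjC ewa) ewb.
    apply/negP => ead; apply: (@no4 a w b d) => //.
    - by rewrite eq_sym.
    - exact: adjC.
    - exact: adjC.
  move=> z; rewrite in_delN => /and3P[zA za neaz] ebz.
  have [zw|//] := Nb z (nbrB b ewb bB z zA ebz) ebz.
  by rewrite zw adjC in neaz.
(* That leaf puts [a], hence [w], on a C7 component of [A]; but [w] has the three neighbours [a],
   [b] and [u]. *)
have [p [q [[_ _ _ _ Nw] _ _]]] : exists p q, [/\ nbr2 A w p q,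
    C7_component A p & C7_component A q].
  apply: C7_nbr2; apply: C7_adj (adjC ewa) wA.
  exact: leaf_delN_C7 wcA IH noleaf _ aA _ _ bleaf.
have au : a != u by apply: contraNneq uNB => <-.
have bu : b != u by apply: contraNneq uNB => <-.
have [E1|E1] := Nw a aA ewa; have [E2|E2] := Nw b (delN_sub bB) ewb;
  have [E3|E3] := Nw u uA (adjC euw);
  by move: ab au bu; rewrite E1 E2 E3 eqxx ?andbF.
Qed.


(** * From a C7 component to the equivalences *)

Lemma C7_isomorphic x : connected e -> C7_component setT x ->
  isomorphic e (@cycle_graph 7).
Proof.
move=> e_conn [c [_ per Nc]].
have per_mod k : c (k %% 7) = c k.
  rewrite [in RHS](divn_eq k 7); elim: (k %/ 7) => [//|q ->].
  by rewrite mulSn -addnA [7 + _]addnC per.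
have Nck k : nbr2 setT (c k) (c (k + 6)) (c k.+1).
  by have := Nc (k + 6); rewrite -!addnS per -[k + 8]addSnnS per.
have adj k : e (c k) (c k.+1) by have [_ _ _ []] := Nck k.
have neq2 k : c k != c k.+2 by have [] := Nc k.
have neq3 k : c k != c k.+3.
  by apply: contraTneq (adj k) => ->; exact: no_triangle_edge (adj k.+1) (adj k.+2).
(* Shifts up to 3 are excluded by irreflexivity, distinct neighbours and absence of triangles; a
   shift [d] from 4 to 6 is the shift [7 - d] read from the other end. *)
have neq k d : 0 < d < 7 -> c k != c (k + d).
  have short m r : 0 < r < 4 -> c m != c (m + r).
    case: r => [|[|[|[|//]]]] // _; rewrite ?addn1 ?addn2 ?addn3 //.
    exact: adj_neq.
  move=> /andP[d0 d7]; have [d4|d4] := ltnP d 4; first by apply: short; rewrite d0.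
  rewrite eq_sym -(per k) -(subnKC (ltnW d7)) addnA; apply: short.
  by rewrite subn_gt0 d7 ltnS leq_subLR (leq_add2r 3 4 d).
pose g (i : 'I_7) := c i.
have g_lt (i j : 'I_7) : i < j -> g i <> g j.
  move=> lt; have := @neq i (j - i); rewrite subn_gt0 lt subnKC ?(ltnW lt) //.
  by rewrite (leq_ltn_trans (leq_subr _ _)) // => /(_ isT)/eqP.
have g_inj : injective g.
  move=> i j gij; apply: val_inj; case: (ltngtP i j) => // lt.
    by case: (g_lt i j lt gij).
  by case: (g_lt j i lt (esym gij)).
have gS i : g (ordS i) = c i.+1 by rewrite -per_mod.
have gP i : g (ord_pred i) = c (i + 6) by rewrite -per_mod /g /= addnS.
have g_nbr i y : e (g i) y -> y = g (ordS i) \/ y = g (ord_pred i).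
  rewrite gS gP => ey; have [_ _ _ _ N] := Nck i.
  by have [->|->] := N y (in_setT y) ey; [right | left].
(* The image of [g] is closed under adjacency, so connectivity makes it everything. *)
have g_onto y : y \in codom g.
  move: y; suff h y : y \in [set g i | i in 'I_7].
    by move=> y; have /imsetP[i _ ->] := h y; exact: codom_f.
  have g0 : g ord0 \in [set g i | i in 'I_7] by exact: imset_f.
  apply: (connected_closed e_conn g0) => a b /imsetP[i _ ->].
  by move=> /g_nbr[]->; exact: imset_f.
pose f y := iinv (g_onto y).
have gK : cancel g f by move=> i; apply: g_inj; rewrite f_iinv.
have fK : cancel f g by move=> y; rewrite f_iinv.
exists f; first by exists g.
move=> y z; rewrite -{2}(fK y) -{2}(fK z); move: (f y) (f z) => i j.
apply/orP/idP => [[/eqP->|/eqP->] | /g_nbr[]/g_inj->].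
- by rewrite gS adj.
- by rewrite e_sym gS adj.
- by left.
- by right; rewrite ord_predK.
Qed.

End LargeGirth.
End Graph.

(** The classification applied to the whole vertex set: by connectivity an isolated vertex would
    give [K_1] and a C7 component [C_7], so every vertex lies on a pendant edge. *)
Lemma well_covered_pairing (T : finType) (e : rel T) :
  symmetric e -> irreflexive e -> connected e -> girth_at_least e 6 ->
  ~ isomorphic e (@cycle_graph 7) -> ~ isomorphic e (@complete_graph 1) ->
  well_covered e -> exists f, pendant_pairing e f.
Proof.
move=> e_sym e_irr e_conn girth6 notC7 notK1 /forallP wc.
have neq a b : e a b -> a != b by exact: adj_neq.
have no_cycle (c : seq T) : 2 < size c < 6 -> uniq c -> cycle e c -> False.
  by move=> sc uc; apply/negP; exact: girth_cycle girth6 sc uc.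
have no3 a b c : e a b -> e b c -> e c a -> False.
  move=> ab bc ca; apply: (@no_cycle [:: a; b; c]); rewrite //= ?ab ?bc ?ca //.
  by rewrite !inE negb_or !neq // e_sym.
have no4 a b c d : a != c -> b != d ->
    e a b -> e b c -> e c d -> e d a -> False.
  move=> ac bd ab bc cd da; apply: (@no_cycle [:: a; b; c; d]) => //=.
    by rewrite !inE !negb_or ac bd !neq // e_sym.
  by rewrite ab bc cd da.
(* If two vertices of the closed walk coincide, it contains a triangle; hence no inequalities are
   assumed here. *)
have no5 a b c d f : e a b -> e b c -> e c d -> e d f -> e f a -> False.
  move=> ab bc cd df fa.
  have ac : a != c by apply/eqP => E; subst c; exact: no3 cd df fa.
  have ad : a != d by apply/eqP => E; subst d; exact: no3 ab bc cd.
  have bd : b != d by apply/eqP => E; subst d; exact: no3 df fa ab.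
  have bf : b != f by apply/eqP => E; subst f; exact: no3 bc cd df.
  have cf : c != f by apply/eqP => E; subst f; exact: no3 fa ab bc.
  apply: (@no_cycle [:: a; b; c; d; f]) => //=.
    by rewrite !inE !negb_or ac ad bd bf cf !neq // e_sym.
  by rewrite ab bc cd df fa.
have wcT : well_covered_in e setT.
  move=> S S'; suff max U : maximal_stable_in e setT U -> #|U| = alpha e.
    by move=> /max-> /max->.
  move=> /(maximal_stable_inP e_sym e_irr).
  rewrite (@maxset_eq _ _ (stable e)); last by move=> V; rewrite subsetT andbT.
  by move=> mU; have /implyP/(_ mU)/andP[_ /eqP] := wc U.
have paired x : pendant_paired e setT x.
  have [iso | // | c7] := well_covered_good e_sym e_irr no3 no4 no5 wcT (in_setT x).
    by case: notK1; exact: (isolated_isomorphic e_sym e_irr e_conn (x := x) (fun y => iso y (in_setT y))).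
  by case: notC7; exact: C7_isomorphic c7.
apply: pairing_of_pendant_neighbours => // [x | l l' s pl pl' els el's].
  have [y [xy|yx]] := paired x; exists y.
  - by case: xy.
  - by rewrite (leaf_pendant xy).
  - by case: yx; rewrite e_sym.
  - by rewrite (leaf_pendant yx) orbT.
exact: leaf_unique wcT (pendant_leaf pl els) (pendant_leaf pl' el's).
Qed.

(** For [K_2], conditions (i), (ii), (iii) and (v) hold, but (iv) fails: there are two pendant
    vertices while the independence number is 1. Hence the five-fold equivalence is stated away from
    [K_2], and the other two clauses record what remains true there. *)
Theorem theorem3 (T : finType) (e : rel T)
    (e_sym : symmetric e) (e_irr : irreflexive e)
    (e_conn : connected e) (e_girth : girth_at_least e 6)
    (notC7 : ~ isomorphic e (@cycle_graph 7))
    (notK1 : ~ isomorphic e (@complete_graph 1)) :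
  [/\ ~ isomorphic e (@complete_graph 2) ->
      [<-> well_covered e;
           pendant_perfect_matching e;
           very_well_covered e;
           Konig_Egervary_pendant_core e;
           Konig_Egervary e /\ square_stable e],
      [<-> well_covered e;
           pendant_perfect_matching e;
           very_well_covered e;
           Konig_Egervary e /\ square_stable e]
    & Konig_Egervary_pendant_core e -> well_covered e].
Proof.
have wc_pair := well_covered_pairing e_sym e_irr e_conn e_girth notC7 notK1.
have ppm_vwc : pendant_perfect_matching e -> very_well_covered e.
  move=> /(pendant_pairing_of_perfect_matching e_sym e_irr)[f fP].
  exact: (pairing_very_well_covered e_sym e_irr fP).
have wc_ppm : well_covered e -> pendant_perfect_matching e.
  by move=> /wc_pair[f fP]; have [] := pairing_matching e_irr fP.
have vwc_wc : very_well_covered e -> well_covered e by case/and3P.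
have sq_wc : Konig_Egervary e /\ square_stable e -> well_covered e.
  move=> [KE sq]; apply/vwc_wc.
  have [f fP] := square_stable_pairing e_sym e_irr e_conn notK1 KE sq.
  exact: (pairing_very_well_covered e_sym e_irr fP).
have vwc_sq : very_well_covered e -> Konig_Egervary e /\ square_stable e.
  move=> /vwc_wc/wc_pair[f fP]; split.
    exact: (pairing_Konig_Egervary e_sym e_irr fP).
  exact: (pairing_square_stable e_sym e_irr fP).
have core_wc : Konig_Egervary_pendant_core e -> well_covered e.
  move=> /(pendant_core_pairing e_sym e_irr e_conn)[f fP]; apply/vwc_wc.
  exact: (pairing_very_well_covered e_sym e_irr fP).
split; last exact: core_wc.
  move=> notK2; tfae=> //.
    move=> /vwc_wc/wc_pair[f fP]; apply: (pairing_pendant_core e_sym e_irr fP).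
    (* Two adjacent pendant vertices would make the connected graph a [K_2]. *)
    move=> x y px py; apply/negP => exy; apply: notK2.
    exact: (adjacent_pendants_isomorphic e_sym e_irr e_conn px py exy).
  by move=> /core_wc/wc_ppm/ppm_vwc/vwc_sq.
by tfae.
Qed.
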